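(* Let $m, d \geq 1$ and let $\mathcal{S} = \{(x_i, y_i) : i = 1,\dots,m\}$ with $x_i \in \mathbb{R}^d$ and $y_i \in \{-1,1\}$. Then for every $\theta \in \mathbb{R}^d$, $$F_{\log}(\mathcal{S}, \theta) \;=\; \log(2) + \frac{1}{m} \log F^{r}_{\exp}(\mathcal{S}, \theta, \Sigma_m).$$
   Context: $\Sigma_m = \{-1,1\}^m$. For $\sigma \in \Sigma_m$, the Rademacher observation (rado) with signature $\sigma$ is $\pi_\sigma = \frac12 \sum_{i=1}^m (\sigma_i + y_i) x_i \in \mathbb{R}^d$. The logistic risk is $F_{\log}(\mathcal{S}, \theta) = \frac1m \sum_{i=1}^m \log\left(1 + \exp(-y_i \theta^\top x_i)\right)$. For nonempty $\mathcal{U} \subseteq \Sigma_m$ with $|\mathcal{U}| = n$, the exponential rado-risk is $F^{r}_{\exp}(\mathcal{S},\theta,\mathcal{U}) = \frac1n \sum_{\sigma \in \mathcal{U}} \exp(-\theta^\top \pi_\sigma)$. Here $\log$ is the natural logarithm. *)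

(* Defs.v *)
From HB Require Import structures.
From mathcomp Require Import all_boot all_order all_algebra.
From mathcomp Require Import reals sequences exp.

Set Implicit Arguments.
Unset Strict Implicit.
Unset Printing Implicit Defensive.

Import Order.TTheory GRing.Theory Num.Theory.
Local Open Scope ring_scope.

(* The two-element set {-1, 1} of reals as a finType; [\val] is its inclusion
   in R. *)
Notation sign R := (seq_sub [:: -1; 1 : (R : realType)]).

(* Sigma_m = {-1, 1}^m *)
Notation Sigma R m := {ffun 'I_m -> sign R}.

(* An indexed family of m pairs (x_i, y_i): examples may be repeated. *)
Definition sample (R : realType) (m d : nat) : Type :=
  'I_m -> 'cV[R]_d * sign R.

Section Rado.
Variables (R : realType) (m d : nat).
Implicit Types (S : sample R m d) (theta u v : 'cV[R]_d).
Implicit Types (sigma : Sigma R m) (U : {set Sigma R m}).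

Definition dot u v : R := (u^T *m v) ord0 ord0.

Definition obs S (i : 'I_m) : 'cV[R]_d := (S i).1.

Definition label S (i : 'I_m) : R := \val (S i).2.

Definition rado S sigma : 'cV[R]_d :=
  2^-1 *: \sum_(i < m) (\val (sigma i) + label S i) *: obs S i.

Definition logistic_risk S theta : R :=
  m%:R^-1 * \sum_(i < m) ln (1 + expR (- label S i * dot theta (obs S i))).

(* The usual notion for nonempty U; the value is 0 when U is empty. *)
Definition exp_rado_risk S theta U : R :=
  #|U|%:R^-1 * \sum_(sigma in U) expR (- dot theta (rado S sigma)).

End Rado.

(* Main.v *)
(** Since [- dot theta (rado S sigma)] is a sum over i of terms depending on
    [sigma i] only, the sum of its exponential over all of Sigma_m factors into
    a product over i of sums over the two values of [sigma i]. The value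
    opposite to the label y_i contributes 1 and the value equal to it
    contributes [expR (- y_i * dot theta x_i)]. Taking logarithms gives the
    logistic risk, and the normalisation #|Sigma_m| = 2 ^ m gives [ln 2]. *)
Require Import Defs.
From mathcomp Require Import all_boot all_order all_algebra.
From mathcomp Require Import reals sequences exp.
From mathcomp Require Import ring.

Import Order.TTheory GRing.Theory Num.Theory.
Local Open Scope ring_scope.

(** The subtype enumerates each element once, so [s] must not repeat any. *)
Lemma sum_seq_sub (V : nmodType) (T : choiceType) (s : seq T) (F : T -> V) :
  uniq s -> \sum_(x : seq_sub s) F (\val x) = \sum_(x <- s) F x.
Proof.
move=> s_uniq; rewrite -big_enum -(big_map \val predT F) enumT.
suff -> : [seq \val x | x <- Finite.enum (seq_sub s)] = s by [].
by rewrite unlock val_seq_sub_enum.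
Qed.

(** If -1 and 1 coincided, 2 would vanish in [R]. *)
Lemma uniq_signs (R : realType) : uniq [:: -1; 1 : R].
Proof. by rewrite /= inE -subr_eq0 -opprD oppr_eq0 -[1 + 1]/2%:R pnatr_eq0. Qed.

Lemma card_sign (R : realType) : #|{: sign R}| = 2.
Proof. by rewrite (card_seq_sub (uniq_signs R)). Qed.

Lemma sum_sign (R : realType) (F : R -> R) :
  \sum_(s : sign R) F (\val s) = F (-1) + F 1.
Proof.
by rewrite (sum_seq_sub _ _ _ _ (uniq_signs R)) big_cons big_seq1.
Qed.

Lemma signP (R : realType) (s : sign R) : \val s = -1 \/ \val s = 1.
Proof. by have := valP s; rewrite !inE => /orP[]/eqP->; [left|right]. Qed.

Lemma ln_prod (R : realType) (I : finType) (F : I -> R) :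
  (forall i, 0 < F i) -> ln (\prod_i F i) = \sum_i ln (F i).
Proof.
move=> F_gt0.
(* Positivity of the partial products is carried through the induction because [lnM] requires it. *)
suff [] : 0 < \prod_i F i /\ ln (\prod_i F i) = \sum_i ln (F i) by [].
apply: (big_ind2 (fun p s => 0 < p /\ ln p = s)) => [|p s q t [p0 <-] [q0 <-]|i _].
- by rewrite ln1.
- by rewrite mulr_gt0 ?lnM.
- by split.
Qed.

Lemma dot_rado (R : realType) (m d : nat) (S : sample R m d) (theta : 'cV[R]_d)
    (sigma : Sigma R m) :
  dot theta (rado S sigma) =
  \sum_i (\val (sigma i) + label S i) / 2 * dot theta (obs S i).
Proof.
rewrite /dot /rado -scalemxAr mxE mulmx_sumr summxE mulr_sumr.
by apply: eq_bigr => i _; rewrite -scalemxAr mxE mulrA [2^-1 * _]mulrC.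
Qed.

Lemma sum_expR_dot_rado (R : realType) (m d : nat) (S : sample R m d)
    (theta : 'cV[R]_d) :
  \sum_(sigma : Sigma R m) expR (- dot theta (rado S sigma)) =
  \prod_i (1 + expR (- label S i * dot theta (obs S i))).
Proof.
pose F i (s : R) := expR (- ((s + label S i) / 2 * dot theta (obs S i))).
transitivity (\sum_(sigma : Sigma R m) \prod_i F i (\val (sigma i))).
  by apply: eq_bigr => sigma _; rewrite dot_rado -sumrN expR_sum.
rewrite -(bigA_distr_bigA (fun i (s : sign R) => F i (\val s))).
apply: eq_bigr => i _; rewrite sum_sign /F.
have [->|->] : label S i = -1 \/ label S i = 1 by exact: signP.
(* Here the vanishing exponent comes from [s = 1], the second summand, hence the swap; for [s = -1]
   the coefficient [(s + label S i) / 2] is the label itself. *)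
- by rewrite subrr mul0r mul0r oppr0 expR0 addrC; congr (_ + expR _); field.
- by rewrite addNr mul0r mul0r oppr0 expR0; congr (_ + expR _); field.
Qed.

Theorem lemma2 (R : realType) (m d : nat) (m_ge1 : (1 <= m)%N)
    (d_ge1 : (1 <= d)%N) (S : sample R m d) (theta : 'cV[R]_d) :
  logistic_risk S theta
  = ln 2 + m%:R^-1 * ln (exp_rado_risk S theta [set: Sigma R m]).
Proof.
have G_gt0 i : 0 < 1 + expR (- label S i * dot theta (obs S i)).
  by rewrite addr_gt0 ?expR_gt0.
have m_neq0 : m%:R != 0 :> R by rewrite pnatr_eq0 -lt0n.
rewrite /exp_rado_risk cardsT card_ffun card_sign card_ord.
under eq_bigl do rewrite inE.
rewrite sum_expR_dot_rado lnM ?posrE ?invr_gt0 ?prodr_gt0 ?ltr0n ?expn_gt0 //.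
rewrite lnV ?posrE ?ltr0n ?expn_gt0 // natrX lnXn ?ltr0n // ln_prod //.
(* The normalisation left [- (ln 2 *+ m)]; divided by [m], which is nonzero, it cancels the leading
   [ln 2]. *)
by rewrite mulrDr mulrN -[ln 2 *+ m]mulr_natl mulKf // addrA subrr add0r.
Qed.
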